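(* Let $M\ge 1$, $N\ge 2$, let $k_1,\dots,k_M>0$ be wave numbers, let $x_1,\dots,x_N$ be the imaging pixels with total path lengths $L_1,\dots,L_N$, and let $A=(e^{-jk_iL_n})_{1\le i\le M,\,1\le n\le N}$ be the sensing matrix. Assume that two point targets are located at pixels $x_p$ and $x_q$ ($p\neq q$), i.e. the exact solution $X^o\in\mathbb{C}^N$ has $p$-th and $q$-th entries equal to $1$ and all other entries equal to $0$. Let $b=AX^o$ and $\tilde X=A^*b$, and write the two reconstructed values as $\tilde X_p=Ce^{j\theta}$ and $\tilde X_q=Ce^{-j\theta}$ with magnitude $C>0$ and phases $\theta$ and $-\theta$. Then $\theta$ cannot be $\pi$ (modulo $2\pi$).
   Context: Setting: a noiseless linear imaging system $AX=b$ with a single transmitter $T_x$, a single receiver $R_x$, and $M$ frequencies with wave numbers $k_1,\dots,k_M>0$. The imaging area has $N$ pixels located at points $x_1,\dots,x_N$ of Euclidean space, and $L_n=|T_x-x_n|+|x_n-R_x|$ is the total path length from the transmitter to $x_n$ and then to the receiver. Here $j$ is the imaginary unit. The sensing matrix $A$ is the $M\times N$ complex matrix with $(i,n)$ entry $e^{-jk_iL_n}$, and $A^*$ is its conjugate transpose. The data are generated synthetically (''inverse crime'') by $b=AX^o$, where $X^o\in\mathbb{C}^N$ is the exact reflectivity vector (interference between the targets is neglected), and the reconstructed solution is $\tilde X=A^*b$. The reconstructed values of the point targets at pixels $x_p,x_q$ are the entries $\tilde X_p,\tilde X_q$, which are complex conjugates of each other. Phases are considered modulo $2\pi$ (wrapped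 phase, so $\pi$ and $-\pi$ are the same). *)

(* Defs.v *)
(* MathComp / MathComp-Analysis; complex numbers are R[i] over R : realType. *)
From mathcomp Require Export all_boot all_order all_algebra.
From mathcomp Require Export reals trigo complex.

Set Implicit Arguments.
Unset Strict Implicit.
Unset Printing Implicit Defensive.

Import Order.TTheory GRing.Theory Num.Theory.
Local Open Scope ring_scope.
Local Open Scope complex_scope.

(* The norm `|v| that MathComp-Analysis puts on 'rV[R]_d is the sup norm, hence
   this explicit Euclidean distance. *)
Definition eucl_dist (R : realType) (d : nat) (u v : 'rV[R]_d) : R :=
  Num.sqrt (\sum_(l < d) (u 0 l - v 0 l) ^+ 2).

Definition path_length (R : realType) (d : nat) (Tx Rx x : 'rV[R]_d) : R :=
  eucl_dist Tx x + eucl_dist x Rx.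

(* e^{jt} for real t, by Euler's formula. *)
Definition expi (R : realType) (t : R) : R[i] := cos t +i* sin t.

Definition sensing_mx (R : realType) (M N : nat)
    (k : 'I_M -> R) (L : 'I_N -> R) : 'M[R[i]]_(M, N) :=
  \matrix_(i < M, n < N) expi (- (k i * L n)).

(* Main.v *)
(* Since [b_i = A_ip + A_iq] and [|A_ip| = 1], the real part of
   [Xt_p = \sum_i conj(A_ip) (A_ip + A_iq)] is [\sum_i (1 + cos (k_i (L_p - L_q)))],
   which is nonnegative, whereas the phase [pi] would make it [- C < 0]. *)
Require Import Defs.
From mathcomp Require Import all_boot all_order all_algebra.
From mathcomp Require Import reals trigo complex ring.

Import Order.TTheory GRing.Theory Num.Theory.
Local Open Scope ring_scope.
Local Open Scope complex_scope.
Local Open Scope sesquilinear_scope.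

(** Evenness of the cosine reduces to [m >= 0], where induction adds one period at a time. *)
Lemma cos_odd_mul_pi (R : realType) (m : int) :
  cos (pi + m%:~R * (2 * pi)) = -1 :> R.
Proof.
rewrite addrC cosDpi; congr (- _).
wlog m_ge0 : m / 0 <= m => [IH|].
  have [/IH //|/ltW m_le0] := leP 0 m.
  by rewrite -cosN -mulNr -mulrNz IH ?oppr_ge0.
case: m m_ge0 => // n _; rewrite -pmulrn (mulr_natl pi 2).
elim: n => [|n IH]; first by rewrite mul0r cos0.
by rewrite -natr1 mulrDl mul1r cosD2pi.
Qed.

(** The product equals $1 + e^{j(t-s)}$, with real part [1 + cos (s - t)]. *)
Lemma Re_conj_expi_mulD_ge0 (R : realType) (s t : R) :
  0 <= complex.Re ((expi s)^* * (expi s + expi t)).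
Proof.
have -> : complex.Re ((expi s)^* * (expi s + expi t)) = 1 + cos (s - t).
  by rewrite cosB -(cos2Dsin2 s) /=; ring.
by rewrite -lerBlDl sub0r cos_geN1.
Qed.

Theorem theorem4 (R : realType) (d M N : nat)
  (hM : (1 <= M)%N) (hN : (2 <= N)%N)
  (k : 'I_M -> R) (hk : forall i : 'I_M, 0 < k i)
  (Tx Rx : 'rV[R]_d) (x : 'I_N -> 'rV[R]_d)
  (L : 'I_N -> R) (hL : forall n : 'I_N, L n = path_length Tx Rx (x n))
  (A : 'M[R[i]]_(M, N)) (hA : A = sensing_mx k L)
  (p q : 'I_N) (hpq : p <> q)
  (Xo : 'cV[R[i]]_N) (hXp : Xo p 0 = 1) (hXq : Xo q 0 = 1)
  (hX0 : forall n : 'I_N, n <> p -> n <> q -> Xo n 0 = 0)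
  (b : 'cV[R[i]]_M) (hb : b = A *m Xo)
  (Xt : 'cV[R[i]]_N) (hXt : Xt = A^t* *m b)
  (C theta : R) (hC : 0 < C)
  (hp : Xt p 0 = C%:C * expi theta)
  (hq : Xt q 0 = C%:C * expi (- theta)) :
  ~ exists m : int, theta = pi + m%:~R * (2 * pi).
Proof.
case=> m theta_pi.
have bE i : b i 0 = A i p + A i q.
  (* Splitting off [q] after [p] requires [q != p], which is [hpq]. *)
  rewrite hb mxE (bigD1 p) //= (bigD1 q) /=; last exact/eqP/nesym.
  rewrite big1 => [|n /andP[/eqP np /eqP nq]]; last by rewrite hX0 ?mulr0.
  by rewrite hXp hXq !mulr1 addr0.
have Re_ge0 : 0 <= complex.Re (Xt p 0).
  (* The real part is additive, so each frequency is treated separately. *)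
  rewrite hXt mxE raddf_sum sumr_ge0 // => i _.
  by rewrite bE hA !mxE; exact: Re_conj_expi_mulD_ge0.
(* As [C] is real, the sine of the phase enters only with coefficient 0 and need not be
   evaluated. *)
move: Re_ge0; rewrite hp theta_pi /= cos_odd_mul_pi.
by rewrite mul0r subr0 mulrN1 oppr_ge0 leNgt hC.
Qed.
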